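(* Let $k\ge 4$ be an even integer. For $\tau$ in the upper half-plane $\mathbb H=\{\tau\in\mathbb C:\operatorname{Im}\tau>0\}$ let $$E_k(\tau)=\sum_{\substack{m,n\in\mathbb Z\\ (m,n)\neq(0,0)}}\frac{1}{(m+n\tau)^k}.$$ Then for all $\tau\in\mathbb H$ and all $\begin{pmatrix}a&b\\c&d\end{pmatrix}\in\mathrm{SL}_2(\mathbb Z)$, $$E_k\left(\frac{a\tau+b}{c\tau+d}\right)=(c\tau+d)^k E_k(\tau).$$
   Context: $E_k(\tau)$ is the Eisenstein series $\sum_{\omega\in\Lambda\setminus\{0\}}\omega^{-k}$ of the lattice $\Lambda=\{m+n\tau: m,n\in\mathbb Z\}$ generated by $1$ and $\tau$. *)

(* Defs.v *)
From HB Require Import structures.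
From mathcomp Require Import all_boot all_order all_algebra.
From mathcomp Require Import complex.
From mathcomp Require Import all_classical all_reals all_analysis.
From mathcomp.analysis.showcase Require Import summability.
Import Order.TTheory GRing.Theory Num.Theory.
Import numFieldNormedType.Exports.

Set Implicit Arguments.
Unset Strict Implicit.
Unset Printing Implicit Defensive.

Local Open Scope classical_set_scope.
Local Open Scope ring_scope.
Local Open Scope complex_scope.

(* R[i] is only declared a numFieldType; this puts on it the topology of the
   modulus that every numFieldType carries. *)
HB.instance Definition _ (R : rcfType) :=
  NormedModule.copy R[i] (R[i] : numFieldType).

Definition lattice_index := {mn : int * int | mn != (0, 0)}.

Definition eisenstein_term (R : realType) (k : nat) (tau : R[i])
    (p : lattice_index) : R[i] :=
  let: (m, n) := val p in 1 / (m%:~R + n%:~R * tau) ^+ k.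

(* The limit of the finite partial sums along the directed set of finite sets
   of indices, i.e. an unordered sum; like any [lim], it is meaningful only
   when these partial sums converge. *)
Definition eisenstein (R : realType) (k : nat) (tau : R[i]) : R[i] :=
  sum (eisenstein_term k tau).

Definition eisenstein_converges (R : realType) (k : nat) (tau : R[i]) : Prop :=
  cvg (partial_sum (eisenstein_term k tau) @ totally).

Definition moebius (R : realType) (A : 'M[int]_2) (tau : R[i]) : R[i] :=
  ((A 0 0)%:~R * tau + (A 0 1)%:~R) / ((A 1 0)%:~R * tau + (A 1 1)%:~R).

(* Main.v *)
(* Since m^2 + n^2 <= D |m + n tau|^2 for a constant D depending on tau, the
   terms are dominated, for k >= 4, by a multiple of (m^2 + n^2)^-2, hence of
   1 / ((1 + m^2) (1 + n^2)), whose finite sums are bounded; this gives absolute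
   and so unordered convergence.  Over the denominator c tau + d, the lattice
   point m + n (a tau + b) / (c tau + d) becomes (dm + bn) + (cm + an) tau.  As
   (m, n) |-> (dm + bn, cm + an) permutes the nonzero integer pairs, the
   unordered sum is only rescaled. *)
Require Import Defs.
From HB Require Import structures.
From mathcomp Require Import all_boot all_order all_algebra.
From mathcomp Require Import complex.
From mathcomp Require Import all_classical all_reals all_analysis.
From mathcomp Require Import finmap ring lra.
From mathcomp.analysis.showcase Require Import summability.
Import Order.TTheory GRing.Theory Num.Theory.
Import numFieldNormedType.Exports.
Set Implicit Arguments.
Unset Strict Implicit.

Local Open Scope ring_scope.
Local Open Scope complex_scope.

#[local] Existing Instance totally_filter.

(** * Unordered sums: convergence by domination, and reindexing *)

Lemma partial_sumE (I : choiceType) (V : zmodType) (x : I -> V) (A : {fset I}) :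
  partial_sum x A = \sum_(i <- A) x i.
Proof. by rewrite big_seq_fsetE. Qed.

Lemma ler_sum_uniq_sub (R : numDomainType) (I : eqType) (s t : seq I)
    (f : I -> R) : (forall i, 0 <= f i) -> uniq s -> uniq t ->
  {subset s <= t} -> \sum_(i <- s) f i <= \sum_(i <- t) f i.
Proof.
move=> f_ge0 us ut st; rewrite (perm_big [seq i <- t | i \in s]).
  by rewrite big_filter [leRHS](bigID (mem s))/= lerDl sumr_ge0.
apply: uniq_perm; rewrite ?filter_uniq// => i.
by rewrite mem_filter andb_idr// => /st.
Qed.

(** Finite sums of nonnegative terms increase with the index set, so when bounded they converge to
    their supremum. *)
Lemma cvg_partial_sum_ge0 (R : realType) (I : choiceType) (x : I -> R) (M : R) :
    (forall i, 0 <= x i) -> (forall A : {fset I}, \sum_(i <- A) x i <= M) ->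
  cvg (partial_sum x @ totally)%classic.
Proof.
move=> x_ge0 x_le.
pose E : set R := range (partial_sum x).
have supE : has_sup E.
  split; first by exists (partial_sum x fset0); exists fset0.
  by exists M => _ [A _ <-]; rewrite partial_sumE.
apply/cvg_ex; exists (sup E); apply/cvgrPdist_lt => e e_gt0.
have [_ [A _ <-] ltA] := sup_adherent e_gt0 supE.
exists A => //= B AB.
have leB : partial_sum x B <= sup E by apply: sup_upper_bound => //; exists B.
have leAB : partial_sum x A <= partial_sum x B.
  rewrite !partial_sumE ler_sum_uniq_sub ?fset_uniq//.
  exact/fsubsetP.
rewrite ger0_norm ?subr_ge0//; lra.
Qed.

(** Write [x] as [(x + y) - y]: both families are nonnegative, with finite sums bounded by [M + M]
    and [M]. *)
Lemma cvg_partial_sum_real (R : realType) (I : choiceType) (x y : I -> R)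
    (M : R) : (forall i, `|x i| <= y i) ->
    (forall A : {fset I}, \sum_(i <- A) y i <= M) ->
  cvg (partial_sum x @ totally)%classic.
Proof.
move=> xy y_le.
have y_ge0 i : 0 <= y i by apply: le_trans (xy i).
have -> : partial_sum x =
    (partial_sum (fun i => x i + y i) - partial_sum y : {fset I} -> R).
  apply/funext => A; rewrite [RHS]/= !fctE !partial_sumE big_split/=; ring.
apply: is_cvgB; last exact: cvg_partial_sum_ge0 y_le.
apply: (@cvg_partial_sum_ge0 _ _ _ (M + M)) => [i|A].
  by have := xy i; rewrite ler_norml => /andP[]; lra.
rewrite big_split lerD//; apply: le_trans (y_le A).
by apply: ler_sum => i _; apply: le_trans (xy i); apply: ler_norm.
Qed.

Lemma cvg_real_complex (R : realType) (T : Type) (F : set_system T)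
    (FF : Filter F) (f : T -> R) (a : R) :
  (f @ F --> a)%classic -> ((fun t => (f t)%:C) @ F --> (a%:C : R[i]))%classic.
Proof.
move=> /cvgrPdist_lt fa; apply/cvgrPdist_lt => e e_gt0.
(* A positive element of [R[i]] has zero imaginary part, so the tolerance is a real number. *)
have eE : e = (complex.Re e)%:C by rewrite RRe_real// gtr0_real.
have Re_gt0 : 0 < complex.Re e by rewrite -ltcR -eE.
apply: filterS (fa _ Re_gt0) => t.
rewrite eE -raddfB normc_def /= expr0n addr0 sqrtr_sqr.
by rewrite ltcR.
Qed.

Lemma ler_Re_normc (R : rcfType) (z : R[i]) : `|complex.Re z|%:C <= `|z|.
Proof.
by rewrite normc_def lecR -sqrtr_sqr ler_wsqrtr// lerDl sqr_ge0.
Qed.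

Lemma ler_Im_normc (R : rcfType) (z : R[i]) : `|complex.Im z|%:C <= `|z|.
Proof.
by rewrite normc_def lecR -sqrtr_sqr ler_wsqrtr// lerDr sqr_ge0.
Qed.

(** The real and imaginary parts are each dominated by [y]; their sums converge separately and are
    recombined. *)
Lemma cvg_partial_sum_complex (R : realType) (I : choiceType) (x : I -> R[i])
    (y : I -> R) (M : R) : (forall i, `|x i| <= (y i)%:C) ->
    (forall A : {fset I}, \sum_(i <- A) y i <= M) ->
  cvg (partial_sum x @ totally)%classic.
Proof.
move=> xy y_le.
have /cvg_ex[/= a cvgRe] : cvg (partial_sum (fun i => complex.Re (x i)) @ totally)%classic.
  apply: cvg_partial_sum_real y_le => i.
  by rewrite -lecR; exact: le_trans (ler_Re_normc (x i)) (xy i).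
have /cvg_ex[/= b cvgIm] : cvg (partial_sum (fun i => complex.Im (x i)) @ totally)%classic.
  apply: cvg_partial_sum_real y_le => i.
  by rewrite -lecR; exact: le_trans (ler_Im_normc (x i)) (xy i).
apply/cvg_ex; exists (a%:C + 'i * b%:C).
have -> : partial_sum x = (fun A => (partial_sum (fun i => complex.Re (x i)) A)%:C) \+
    (fun A => 'i * (partial_sum (fun i => complex.Im (x i)) A)%:C).
  apply/funext => A /=; rewrite !partial_sumE !raddf_sum mulr_sumr -big_split/=.
  by apply: eq_bigr => i _; rewrite -complexE.
by apply: cvgD; [|apply: cvgMl_tmp]; apply: cvg_real_complex.
Qed.

Lemma cvg_partial_sum_reindex (I J : choiceType) (V : zmodType)
    (F : set_system V) (x : J -> V) (f : I -> J) (g : J -> I) :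
    cancel f g -> cancel g f ->
  (partial_sum x @ totally `=>` F ->
   partial_sum (x \o f) @ totally `=>` F)%classic.
Proof.
move=> fK gK cvgx.
have -> : partial_sum (x \o f) = partial_sum x \o (fun A => f @` A)%fset.
  apply/funext => A /=; rewrite !partial_sumE big_imfset//=.
  by move=> i j _ _; apply: (can_inj fK).
apply: cvg_comp cvgx; apply/filter_fromP => A _.
(* Once [B] contains the image of [A] under [g], its image under [f] contains [A]; hence direct
   images under [f] respect the filter [totally]. *)
exists (g @` A)%fset => //= B gAB; apply/fsubsetP => j jA.
apply/imfsetP; exists (g j); rewrite /= ?gK//.
by apply: (fsubsetP gAB); apply: in_imfset.
Qed.

(** * Uniform bounds on finite sums over integers and pairs of integers *)

Lemma sum_nat_inv_sqr_le (R : realFieldType) (n : nat) :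
  \sum_(0 <= j < n) (1 + j%:R ^+ 2)^-1 <= 4 - 4 / n.+1%:R :> R.
Proof.
elim: n => [|n IHn]; first by rewrite big_geq// divr1 subrr.
rewrite big_nat_recr//= (le_trans (lerD IHn (lexx _)))//.
rewrite -(natr1 n.+1) -(natr1 n); set t := n%:R.
have t_ge0 : 0 <= t :> R by [].
have -> : 4 / (t + 1 + 1) = 4 / (t + 1) - 4 / ((t + 1) * (t + 2)) :> R.
  by field; rewrite !gt_eqF//; lra.
(* The bound [4 - 4 / n.+1] is made to telescope. Clearing denominators leaves 3t^2 - 3t + 2 >= 0,
   whose discriminant is negative. *)
suff : (1 + t ^+ 2)^-1 <= 4 / ((t + 1) * (t + 2)) by lra.
rewrite -[leLHS]mul1r ler_pdivrMr ?ltr_wpDr ?sqr_ge0// mulrAC.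
by rewrite ler_pdivlMr ?mulr_gt0//; nra.
Qed.

Lemma sum_int_inv_sqr_le (R : realFieldType) (s : seq int) : uniq s ->
  \sum_(m <- s) (1 + m%:~R ^+ 2)^-1 <= 8 :> R.
Proof.
move=> us; pose h (m : int) : R := (1 + m%:~R ^+ 2)^-1.
have h_ge0 m : 0 <= h m by rewrite invr_ge0 addr_ge0// sqr_ge0.
pose N := (\max_(m <- s) `|m|%N).+1.
have le4 n : 4 - 4 / n.+1%:R <= 4 :> R by rewrite gerBl.
(* The integers from -N to N - 1, split by sign; each half contributes at most 4. *)
pose t := [seq Posz j | j <- index_iota 0 N] ++ [seq Negz j | j <- index_iota 0 N].
have ut : uniq t.
  rewrite cat_uniq !map_inj_uniq ?iota_uniq ?andbT; try by move=> i j [].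
  by apply/hasPn => _ /mapP[j _ ->]; apply/mapP => -[].
have st : {subset s <= t}.
  move=> m ms; have mN : (`|m| < N)%N.
    by rewrite ltnS; exact: (leq_bigmax_seq (F := absz) _ ms).
  rewrite mem_cat; apply/orP; case: m ms mN => j _ jN.
    by left; apply: map_f; rewrite mem_index_iota.
  by right; apply: map_f; rewrite mem_index_iota (ltnW jN).
apply: le_trans (ler_sum_uniq_sub h_ge0 us ut st) _.
rewrite big_cat !big_map/= (_ : 8 = 4 + 4); last by ring.
have posz_le := le_trans (sum_nat_inv_sqr_le R N) (le4 N).
apply: lerD; first exact: posz_le.
apply: le_trans posz_le; apply: ler_sum => j _.
(* [Negz j] is -(j + 1), so its term is at most the one at j. *)
rewrite /h NegzE mulrNz sqrrN lef_pV2 ?posrE ?ltr_wpDr ?sqr_ge0//.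
by rewrite lerD2l ler_pXn2r ?nnegrE ?ler0n// ler_nat.
Qed.

(** Enlarging [s] to the product of its two projections makes the sum factor into two sums, each at
    most 8. *)
Lemma sum_int2_inv_sqr_le (R : realFieldType) (s : seq (int * int)) : uniq s ->
  \sum_(p <- s) (1 + p.1%:~R ^+ 2)^-1 * (1 + p.2%:~R ^+ 2)^-1 <= 64 :> R.
Proof.
move=> us; pose h (m : int) : R := (1 + m%:~R ^+ 2)^-1.
have h_ge0 m : 0 <= h m by rewrite invr_ge0 addr_ge0// sqr_ge0.
pose s1 := undup (map fst s); pose s2 := undup (map snd s).
have st : {subset s <= [seq (m, n) | m <- s1, n <- s2]}.
  move=> [m n] mns; apply/allpairsP; exists (m, n).
  by rewrite !mem_undup; split => //; apply/mapP; exists (m, n).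
have ut : uniq [seq (m, n) | m <- s1, n <- s2].
  by apply: allpairs_uniq; rewrite ?undup_uniq// => -[? ?] [? ?].
apply: (le_trans (ler_sum_uniq_sub (f := fun p => h p.1 * h p.2) _ us ut st)).
  by move=> p; rewrite mulr_ge0.
rewrite big_allpairs -big_distrlr/= (_ : 64 = 8 * 8); last by ring.
by rewrite ler_pM ?sumr_ge0 ?sum_int_inv_sqr_le ?undup_uniq.
Qed.

(** * Domination of the terms of the series *)

Lemma ge1_add_sqr_int (R : numDomainType) (m n : int) : (m, n) != (0, 0) ->
  1 <= m%:~R ^+ 2 + n%:~R ^+ 2 :> R.
Proof.
move=> mn_neq0; rewrite -!rmorphXn -rmorphD ler1z -gtz0_ge1.
rewrite lt0r paddr_eq0 ?sqr_ge0// !sqrf_eq0 -xpair_eqE mn_neq0.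
by rewrite addr_ge0 ?sqr_ge0.
Qed.

Lemma norm_lattice (R : rcfType) (tau : R[i]) (m n : int) :
  `|m%:~R + n%:~R * tau| = (Num.sqrt ((m%:~R + n%:~R * complex.Re tau) ^+ 2 +
                            (n%:~R * complex.Im tau) ^+ 2))%:C.
Proof.
case: tau => x y; rewrite normc_def.
have intE (l : int) : l%:~R = (l%:~R)%:C :> R[i] by rewrite rmorph_int.
by rewrite !intE; do 4 f_equal => /=; ring.
Qed.

(** From a = (a + bx) - bx one gets a^2 <= 2(a + bx)^2 + 2(bx)^2, with gap (a + 2bx)^2, and b^2 =
    (by)^2 / y^2; collecting coefficients gives the constant. The proof exhibits the difference as a
    combination of squares with nonnegative coefficients. *)
Lemma add_sqr_le_lattice (R : realFieldType) (x y a b : R) : 0 < y ->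
  a ^+ 2 + b ^+ 2 <= (2 + (2 * x ^+ 2 + 1) / y ^+ 2) *
    ((a + b * x) ^+ 2 + (b * y) ^+ 2).
Proof.
move=> y_gt0; have y_neq0 : y != 0 by rewrite gt_eqF.
rewrite -subr_ge0.
rewrite (_ : _ - _ = (a + 2 * b * x) ^+ 2 + 2 * (b * y) ^+ 2 +
  (2 * x ^+ 2 + 1) / y ^+ 2 * (a + b * x) ^+ 2); last by field.
by rewrite !(sqr_ge0, addr_ge0, mulr_ge0, invr_ge0).
Qed.

Lemma norm_eisenstein_term_le (R : realType) (k : nat) (tau : R[i]) :
    (4 <= k)%N -> 0 < complex.Im tau ->
  exists2 C : R, 0 <= C & forall p : lattice_index,
    `|eisenstein_term k tau p| <=
      (C * ((1 + (val p).1%:~R ^+ 2)^-1 * (1 + (val p).2%:~R ^+ 2)^-1))%:C.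
Proof.
move=> k_ge4 y_gt0; set x := complex.Re tau; set y := complex.Im tau in y_gt0 *.
pose D : R := 2 + (2 * x ^+ 2 + 1) / y ^+ 2.
have D_gt0 : 0 < D.
  by rewrite ltr_wpDr// !(sqr_ge0, addr_ge0, mulr_ge0, invr_ge0).
exists (3 * Num.sqrt D ^+ k) => [|[[m n] /= mn_neq0]].
  by rewrite mulr_ge0// exprn_ge0 ?sqrtr_ge0.
rewrite /eisenstein_term/= normrM normr1 mul1r normfV normrX norm_lattice.
rewrite -rmorphXn -fmorphV lecR -/x -/y.
set a : R := m%:~R; set b : R := n%:~R; set Q := _ + _.
have ab_ge1 : 1 <= a ^+ 2 + b ^+ 2 by apply: ge1_add_sqr_int.
have ab_le : a ^+ 2 + b ^+ 2 <= D * Q by apply: add_sqr_le_lattice.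
have Q_gt0 : 0 < Q by rewrite -(pmulr_rgt0 _ D_gt0); lra.
(* A base at least 1 is what allows the exponent 4 to be raised to [k]. *)
have sqrtDQ_ge1 : 1 <= Num.sqrt D * Num.sqrt Q.
  by rewrite -sqrtrM ?(ltW D_gt0)// -[leLHS]sqrtr1 ler_sqrt; lra.
have DQ2 : (D * Q) ^+ 2 = (Num.sqrt D * Num.sqrt Q) ^+ 4.
  rewrite -[D in LHS]sqr_sqrtr ?(ltW D_gt0)//.
  by rewrite -[Q in LHS]sqr_sqrtr ?(ltW Q_gt0)// -exprMn -exprM.
have ab_bound : (1 + a ^+ 2) * (1 + b ^+ 2) <= 3 * (Num.sqrt D * Num.sqrt Q) ^+ k.
  apply: (@le_trans _ _ (3 * (Num.sqrt D * Num.sqrt Q) ^+ 4)).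
    (* With S = a^2 + b^2 >= 1, the product is 1 + S + a^2 b^2 <= 3 S^2, and S <= D Q; this is the
       origin of the factor 3. *)
    by rewrite -DQ2; have := sqr_ge0 a; have := sqr_ge0 b; nra.
  by rewrite ler_pM2l// ler_weXn2l.
rewrite -invfM ler_pdivlMr; last by rewrite mulr_gt0// ltr_wpDr ?sqr_ge0.
rewrite mulrC ler_pdivrMr ?exprn_gt0 ?sqrtr_gt0//.
by rewrite -mulrA -exprMn.
Qed.

Lemma eisenstein_cvg (R : realType) (k : nat) (tau : R[i]) :
  (4 <= k)%N -> 0 < complex.Im tau -> eisenstein_converges k tau.
Proof.
move=> k_ge4 tau_gt0.
have [C C_ge0 term_le] := norm_eisenstein_term_le k_ge4 tau_gt0.
apply: (cvg_partial_sum_complex (M := C * 64) term_le) => A.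
rewrite -mulr_sumr ler_wpM2l//.
have := sum_int2_inv_sqr_le R (s := map val A); rewrite big_map; apply.
by rewrite map_inj_uniq ?fset_uniq//; apply: val_inj.
Qed.

(** * The action of a matrix of determinant 1 on the indices *)

Section LatticeAction.
Variables (A : 'M[int]_2) (detA : \det A = 1).

Definition lattice_act (p : int * int) : int * int :=
  (A 1 1 * p.1 + A 0 1 * p.2, A 1 0 * p.1 + A 0 0 * p.2).

(** [lattice_act] has matrix with rows (d, b) and (c, a), again of determinant ad - bc; this is its
    adjugate, hence its inverse. *)
Definition lattice_act_inv (p : int * int) : int * int :=
  (A 0 0 * p.1 - A 0 1 * p.2, A 1 1 * p.2 - A 1 0 * p.1).

Let detE : A 0 0 * A 1 1 - A 0 1 * A 1 0 = 1.
Proof.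
rewrite -detA (expand_det_row _ 0) !big_ord_recl big_ord0 /cofactor !det_mx11 !mxE/=.
have -> : lift ord0 ord0 = 1 :> 'I_2 by apply: val_inj.
have -> : lift 1 0 = 0 :> 'I_2 by apply: val_inj.
by rewrite expr0 expr1 mul1r mulN1r mulrN addr0.
Qed.

Lemma lattice_actK : cancel lattice_act lattice_act_inv.
Proof. by case=> m n; congr pair => /=; rewrite -[RHS]mul1r -detE; ring. Qed.

Lemma lattice_act_invK : cancel lattice_act_inv lattice_act.
Proof. by case=> m n; congr pair => /=; rewrite -[RHS]mul1r -detE; ring. Qed.

Lemma lattice_act_neq0 p : p != (0, 0) -> lattice_act p != (0, 0).
Proof.
apply: contra_neq => p0.
by rewrite -[p]lattice_actK p0 /lattice_act_inv !mulr0 subrr.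
Qed.

Lemma lattice_act_inv_neq0 p : p != (0, 0) -> lattice_act_inv p != (0, 0).
Proof.
apply: contra_neq => p0.
by rewrite -[p]lattice_act_invK p0 /lattice_act !mulr0 addr0.
Qed.

Definition index_act (p : lattice_index) : lattice_index :=
  Sub (lattice_act (val p)) (lattice_act_neq0 (valP p)).

Definition index_act_inv (p : lattice_index) : lattice_index :=
  Sub (lattice_act_inv (val p)) (lattice_act_inv_neq0 (valP p)).

Lemma index_actK : cancel index_act index_act_inv.
Proof. by move=> p; apply: val_inj; rewrite !SubK lattice_actK. Qed.

Lemma index_act_invK : cancel index_act_inv index_act.
Proof. by move=> p; apply: val_inj; rewrite !SubK lattice_act_invK. Qed.

(** The denominator is itself the lattice point with coordinates (d, c), nonzero because the
    determinant is 1, so [add_sqr_le_lattice] bounds its modulus away from 0. *)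
Lemma moebius_denom_neq0 (R : realType) (tau : R[i]) : 0 < complex.Im tau ->
  (A 1 0)%:~R * tau + (A 1 1)%:~R != 0 :> R[i].
Proof.
move=> tau_gt0.
have cd_neq0 : (A 1 1, A 1 0) != (0, 0).
  by apply/eqP => -[d0 c0]; move: detE; rewrite d0 c0 !mulr0.
rewrite -normr_gt0 addrC norm_lattice ltcR sqrtr_gt0.
have D_le := add_sqr_le_lattice (complex.Re tau) (A 1 1)%:~R (A 1 0)%:~R tau_gt0.
have := lt_le_trans (lt_le_trans ltr01 (ge1_add_sqr_int _ cd_neq0)) D_le.
by rewrite pmulr_rgt0// ltr_wpDr// !(sqr_ge0, addr_ge0, mulr_ge0, invr_ge0).
Qed.

Lemma eisenstein_term_moebius (R : realType) (k : nat) (tau : R[i])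
    (p : lattice_index) : 0 < complex.Im tau ->
  eisenstein_term k (moebius A tau) p =
    ((A 1 0)%:~R * tau + (A 1 1)%:~R) ^+ k * eisenstein_term k tau (index_act p).
Proof.
move=> /moebius_denom_neq0; case: p => -[m n] /= mn_neq0 den_neq0.
rewrite /eisenstein_term/= /moebius !rmorphD !rmorphM/=.
set den := _ * tau + _ in den_neq0 *.
rewrite !div1r -!exprVn -exprMn; congr (_ ^+ k).
(* Inversion is injective on the whole field, 0 being its own inverse; after it, multiplying by
   [den] leaves a polynomial identity. *)
apply: invr_inj; rewrite invfM !invrK.
apply: (mulfI den_neq0); rewrite mulVKf// mulrDr mulrCA.
rewrite [_ * (_ / den)]mulrC mulfVK// /den; ring.
Qed.

End LatticeAction.

Theorem proposition12 (R : realType) (k : nat) (k_ge4 : (4 <= k)%N)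
    (k_even : ~~ odd k) :
  forall tau : R[i], 0 < complex.Im tau ->
    eisenstein_converges k tau /\
    forall A : 'M[int]_2, \det A = 1 ->
      eisenstein k (moebius A tau) =
        ((A 1 0)%:~R * tau + (A 1 1)%:~R) ^+ k * eisenstein k tau.
Proof.
move=> tau tau_gt0; have cvgE := eisenstein_cvg k_ge4 tau_gt0.
(* By uniqueness of limits it suffices that the partial sums at [moebius A tau] tend to the
   right-hand side; their convergence is thus deduced from the one at [tau]. *)
split=> // A detA; apply: cvg_lim; first exact: norm_hausdorff.
have -> : partial_sum (eisenstein_term k (moebius A tau)) =
    (fun B => ((A 1 0)%:~R * tau + (A 1 1)%:~R) ^+ k *
              partial_sum (eisenstein_term k tau \o index_act detA) B).
  apply/funext => B; rewrite !partial_sumE mulr_sumr.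
  by apply: eq_bigr => p _; apply: eisenstein_term_moebius.
apply: cvgMl_tmp.
by apply: (cvg_partial_sum_reindex (index_actK detA) (index_act_invK detA)) cvgE.
Qed.
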